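(* Let $V$ be a 3-dimensional complex vector space with a Hermitian form $h$ of signature $(2,1)$, and let $z_1,z_2,z_3\in V$. Put $h_{ij}=h(z_i,z_j)$, $a=h(z_1,z_1)$, $b=h(z_2,z_2)$, $c=h(z_3,z_3)$ and $\tau=h(z_1,z_2)h(z_2,z_3)h(z_3,z_1)$. Then $$\det(h_{ij})_{1\le i,j\le 3}=abc-c\,|h(z_1,z_2)|^2-a\,|h(z_2,z_3)|^2-b\,|h(z_3,z_1)|^2+\tau+\overline{\tau}.$$
   Context: $h$ is linear in the first argument and conjugate-linear in the second, with $h(w,z)=\overline{h(z,w)}$. *)

(* Defs.v *)
From HB Require Import structures.
From mathcomp Require Import all_boot all_order all_algebra.
From mathcomp Require Import complex.
From mathcomp Require Import reals.

Set Implicit Arguments.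
Unset Strict Implicit.
Unset Printing Implicit Defensive.

Import Order.TTheory GRing.Theory Num.Theory.
Local Open Scope ring_scope.

(* Having a basis of size p + q forces \dim {:V} = p + q, so signature (p, q)
   includes nondegeneracy.  In C, [0 < x] entails that x is real. *)
Definition has_signature (C : numClosedFieldType) (V : vectType C)
    (h : {hermitian_sym V for Num.conj}) (p q : nat) : Prop :=
  exists e : (p + q).-tuple V,
    [/\ basis_of fullv e,
        forall i j, i != j -> h (tnth e i) (tnth e j) = 0 &
        forall i : 'I_(p + q),
          if (i < p)%N then 0 < h (tnth e i) (tnth e i)
          else h (tnth e i) (tnth e i) < 0].

Definition gram_mx (C : numClosedFieldType) (V : vectType C)
    (h : {hermitian_sym V for Num.conj}) (n : nat) (z : n.-tuple V) : 'M[C]_n :=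
  \matrix_(i, j) h (tnth z i) (tnth z j).

(* Main.v *)
Require Import Defs.
From HB Require Import structures.
From mathcomp Require Import all_boot all_order all_algebra.
From mathcomp Require Import complex.
From mathcomp Require Import reals.
From mathcomp Require Import ring.

Set Implicit Arguments.
Unset Strict Implicit.
Unset Printing Implicit Defensive.

Import Order.TTheory GRing.Theory Num.Theory.
Local Open Scope ring_scope.

(** The six terms of a 3x3 determinant are sorted by permutation. The identity gives [a * b * c];
    each transposition pairs [h u v] with its conjugate [h v u], giving minus a squared modulus
    times the remaining diagonal entry; the two 3-cycles give [tau] and its conjugate. *)

Lemma det_mx33 (R : comNzRingType) (A : 'M[R]_3) :
  let a i j := A (inord i) (inord j) in
  \det A = a 0%N 0%N * (a 1%N 1%N * a 2%N 2%N - a 1%N 2%N * a 2%N 1%N)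
         - a 0%N 1%N * (a 1%N 0%N * a 2%N 2%N - a 1%N 2%N * a 2%N 0%N)
         + a 0%N 2%N * (a 1%N 0%N * a 2%N 1%N - a 1%N 1%N * a 2%N 0%N).
Proof.
move=> a.
(* Indexing entries by naturals lets the nested [lift]s of the cofactor expansion compute to
   numerals, so equal entries become the same atom for [ring]. *)
have aE i j : A i j = a i j by rewrite /a !inord_val.
rewrite (expand_det_row _ ord0) !big_ord_recl big_ord0 /cofactor.
rewrite !(expand_det_row _ ord0) !big_ord_recl !big_ord0 /cofactor.
by rewrite !det_mx11 !mxE !aE /=; ring.
Qed.

Theorem theorem9p1 (R : realType) (V : vectType R[i])
    (h : {hermitian_sym V for Num.conj})
    (dimV : \dim {: V} = 3%N) (sig_h : has_signature h 2 1)
    (z1 z2 z3 : V) :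
  let a := h z1 z1 in
  let b := h z2 z2 in
  let c := h z3 z3 in
  let tau := h z1 z2 * h z2 z3 * h z3 z1 in
  \det (gram_mx h [tuple z1; z2; z3]) =
    a * b * c - c * `|h z1 z2| ^+ 2 - a * `|h z2 z3| ^+ 2
    - b * `|h z3 z1| ^+ 2 + tau + tau^*.
Proof.
move=> a b c tau.
(* The sign factor in [hermC] is 1 in the Hermitian case. *)
have hC u v : h u v = (h v u)^* by rewrite hermC mul1r.
(* Squared moduli become [x * x^*], and using [hC] backwards removes every conjugate, leaving a
   polynomial identity in the values of [h]. *)
rewrite det_mx33 !mxE !(tnth_nth 0) /= !inordK //= !normCK /tau !rmorphM /= -!hC.
by rewrite -/a -/b -/c; ring.
Qed.
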